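(* Let $p,q\ge 1$ and let $K_{p,q}^0$ be the complete tripartite graph with parts $P=\{v_1^P,\dots,v_p^P\}$, $Q=\{v_1^Q,\dots,v_q^Q\}$ and $\{v_0\}$, with one edge between any two vertices in different parts, rooted at $v_0$. Identifying a function $f:P\cup Q\to\mathbb{N}$ with $(f^P;f^Q)=(f(v_1^P),\dots,f(v_p^P);f(v_1^Q),\dots,f(v_q^Q))$, we have $\mathrm{PPF}_{p,q}=\mathrm{PPF}(K_{p,q}^0)$. Consequently $$|\mathrm{PPF}(K_{p,q}^0)|=p^q(q-1)^{p-1}+q^p(p-1)^{q-1}-(p+q-1)(p-1)^{q-1}(q-1)^{p-1}$$ (with the convention $0^0=1$).
   Context: Lattice paths: for a non-decreasing $\mathbf a=(a_1,\dots,a_p)\in\{0,\dots,q\}^p$, $\mathcal L^\perp_{\mathbf a}$ is the lattice path from $(0,0)$ to $(p,q)$ with unit steps $E=(1,0)$, $N=(0,1)$ whose $i$-th $E$ step lies at height $y=a_i$ for each $i\in[p]$. For a non-decreasing $\mathbf b=(b_1,\dots,b_q)\in\{0,\dots,p\}^q$, $\mathcal L_{\mathbf b}$ is the lattice path from $(0,0)$ to $(p,q)$ whose $j$-th $N$ step lies at $x$-coordinate $b_j$. A path $\mathcal L$ lies weakly above $\mathcal L'$ if for every $i\in[p]$ the height of the $i$-th $E$ step of $\mathcal L$ is at least that of $\mathcal L'$. For a vector $u$, $\mathrm{inc}(u)$ is its non-decreasing rearrangement, and $\mathbf 1$ the all-ones vector. A $(p,q)$-parking function is $f=(f^P;f^Q)$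 with $f^P\in[q+1]^p$, $f^Q\in[p+1]^q$ such that, with $\mathbf a=\mathrm{inc}(f^P)-\mathbf 1$ and $\mathbf b=\mathrm{inc}(f^Q)-\mathbf 1$, $\mathcal L_{\mathbf b}$ lies weakly above $\mathcal L^\perp_{\mathbf a}$; it is prime if moreover $\mathcal L^\perp_{\mathbf a}$ and $\mathcal L_{\mathbf b}$ have no common point other than $(0,0)$ and $(p,q)$. $\mathrm{PPF}_{p,q}$ is the set of prime $(p,q)$-parking functions. Graph notions: for a rooted graph $G=(\Gamma,s)$ (finite, undirected, loopless multigraph with sink $s$), $V$ is the vertex set, $\tilde V=V\setminus\{s\}$, $\mathrm{mult}(vw)$ the number of edges between $v,w$, $\deg^A(v)=\sum_{w\in A}\mathrm{mult}(vw)$. A $G$-parking function is $f:\tilde V\to\mathbb{N}=\{1,2,\dots\}$ such that every nonempty $S\subseteq\tilde V$ contains $v$ with $f(v)\le\deg^{V\setminus S}(v)$. With $G^A$ the induced subgraph on $A\cup\{s\}$ rooted at $s$, $f$ is decomposable w.r.t. an ordered partition $(A,B)$ of $\tilde V$ into nonempty blocks if $f|_A$ is a $G^A$-parking function and $v\mapsto f(v)-\deg^A(v)$ on $B$ is a $G^B$-parking function; $f$ is prime if decomposable w.r.t. no such partition; $\mathrm{PPF}(G)$ is the set of prime $G$-parking functions. *)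

(* Defs.v *)
From mathcomp Require Import all_boot all_order all_algebra.
Set Implicit Arguments. Unset Strict Implicit. Unset Printing Implicit Defensive.

Section Graph.
Variables (V : finType) (s : V) (mult : V -> V -> nat).

Definition deg (A : {set V}) (v : V) : nat := \sum_(w in A) mult v w.

(* f restricted to A is a G^A-parking function, where G^A is the induced
   subgraph on A ∪ {s} rooted at s. Values must lie in N = {1,2,...}. *)
Definition park_on (A : {set V}) (f : V -> nat) : Prop :=
  (forall v, v \in A -> 0 < f v) /\
  (forall S : {set V}, S \subset A -> S != set0 ->
     exists2 v, v \in S & f v <= deg ((A :|: [set s]) :\: S) v).

Definition G_parking (f : V -> nat) : Prop := park_on (~: [set s]) f.

Definition decomposable (f : V -> nat) (A B : {set V}) : Prop :=
  [/\ A != set0, B != set0, A :&: B = set0 & A :|: B = ~: [set s]] /\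
  (park_on A f /\ park_on B (fun v => f v - deg A v)).

Definition prime_G_parking (f : V -> nat) : Prop :=
  G_parking f /\ forall A B : {set V}, ~ decomposable f A B.
End Graph.

(* vertices: None = v_0 (sink), Some (inl i) = v_{i+1}^P, Some (inr j) = v_{j+1}^Q *)
Definition Kpart p q (v : option ('I_p + 'I_q)) : nat :=
  match v with None => 0 | Some (inl _) => 1 | Some (inr _) => 2 end.
Definition Kmult p q (u v : option ('I_p + 'I_q)) : nat :=
  (Kpart u != Kpart v : nat).
Definition liftf p q (f : 'I_p + 'I_q -> nat) (v : option ('I_p + 'I_q)) : nat :=
  if v is Some x then f x else 0.
Definition PPF_K p q (f : 'I_p + 'I_q -> nat) : Prop :=
  prime_G_parking None (@Kmult p q) (liftf f).

(* A path is a word of steps: true = E = (1,0), false = N = (0,1). *)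
(* Places step [st] so that the k-th [st] step sits at coordinate a_k
   (the other coordinate), filling with [fill] steps; ends at [tot]. *)
Fixpoint path_word (st fill : bool) (cur : nat) (a : seq nat) (tot : nat)
  : seq bool :=
  match a with
  | [::] => nseq (tot - cur) fill
  | x :: a' => nseq (x - cur) fill ++ st :: path_word st fill x a' tot
  end.
(* L^perp_a : i-th E step at height a_i, from (0,0) to (p,q) *)
Definition Lperp (q : nat) (a : seq nat) := path_word true false 0 a q.
(* L_b : j-th N step at x-coordinate b_j, from (0,0) to (p,q) *)
Definition Lb (p : nat) (b : seq nat) := path_word false true 0 b p.

Definition path_points (w : seq bool) : seq (nat * nat) :=
  [seq (count id (take k w), count negb (take k w)) | k <- iota 0 (size w).+1].
Definition heightsE (w : seq bool) : seq nat :=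
  [seq count negb (take k w) | k <- iota 0 (size w) & nth false w k].
Definition weakly_above (p : nat) (L L' : seq bool) : Prop :=
  forall i, i < p -> nth 0 (heightsE L') i <= nth 0 (heightsE L) i.

Definition inc (u : seq nat) : seq nat := sort leq u.
Definition minus1 (u : seq nat) : seq nat := [seq x.-1 | x <- u].

Definition PPF_pq p q (fP : 'I_p -> nat) (fQ : 'I_q -> nat) : Prop :=
  let a := minus1 (inc [seq fP i | i <- enum 'I_p]) in
  let b := minus1 (inc [seq fQ j | j <- enum 'I_q]) in
  [/\ forall i, 1 <= fP i <= q.+1,
      forall j, 1 <= fQ j <= p.+1,
      weakly_above p (Lb p b) (Lperp q a) &
      forall pt, pt \in path_points (Lperp q a) -> pt \in path_points (Lb p b) ->
        pt = (0, 0) \/ pt = (p, q)].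

(* Main.v *)
Require Import Defs.
From mathcomp Require Import all_boot all_order all_algebra.
From mathcomp Require Import zify ring.
Import GRing.Theory Num.Theory.

Set Implicit Arguments. Unset Strict Implicit. Unset Printing Implicit Defensive.

(** Put [s = f^P - 1] and [t = f^Q - 1], and write [below s y] for the number of
    entries of [s] smaller than [y]. Both notions of primality say that no
    lattice point (x, y) other than (0, 0) and (p, q) satisfies
    [below s y <= x] and [below t x <= y]: these are the points lying weakly
    below L^perp_a and weakly above L_b, and they are the sizes
    (|A inter P|, |A inter Q|) of first blocks of decompositions, a block of
    minimal size being itself parking.

    For the enumeration, let (g, h) be in {0..Z-1}^p x {0..W-1}^q with Z >= q,
    W >= p, both g and h taking the value 0. There is a unique minimal such
    point (x, y) with x, y >= 1; it cuts out a prime pair of size (x, y), and the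
    remaining entries of g, h are arbitrary above y, x. Hence, with R the number
    of prime pairs,
      (Z^p - (Z-1)^p) (W^q - (W-1)^q)
        = sum_(x, y >= 1) C(p,x) C(q,y) R(x,y) (Z-y)^(p-x) (W-x)^(q-y).
    Being polynomial in Z and W, the identity may be evaluated at Z = W = 1,
    where it becomes a recurrence determining R; the closed formula satisfies
    the same recurrence because finite differences kill low degrees. *)

(** * Lattice paths *)

Definition below (s : seq nat) (y : nat) : nat := count (fun v => v < y) s.
Arguments below : simpl never.

Lemma below0 s : below s 0 = 0.
Proof. by elim: s.  Qed.

Lemma leq_below s y y' : y <= y' -> below s y <= below s y'.
Proof. by move=> le_y; apply: sub_count => v /= /leq_trans; apply. Qed.

Lemma below_size s y : below s y <= size s.
Proof. exact: count_size. Qed.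

Lemma below_all s y : (below s y == size s) = all (fun v => v < y) s.
Proof. by rewrite all_count. Qed.

Lemma below_eq0 s y : (forall v, v \in s -> y <= v) -> below s y = 0.
Proof.
move=> ge_y; apply/eqP; rewrite -leqn0 leqNgt -has_count; apply/hasPn => v vs.
by rewrite -leqNgt ge_y.
Qed.

Lemma below_cons v s y : below (v :: s) y = (v < y) + below s y.
Proof. by []. Qed.

Lemma path_leq_ge x a v : path leq x a -> v \in a -> x <= v.
Proof. by move=> /(order_path_min leq_trans)/allP ge_x /ge_x. Qed.

(** The entries smaller than [y] form a prefix of a sorted list, and [below a y] is its length. *)
Lemma nth_sorted_below a i y : sorted leq a -> i < size a ->
  (nth 0 a i < y) = (i < below a y).
Proof.
elim: a i => [|x a IH] [|i] //= pa lti; rewrite below_cons.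
- case: (ltnP x y) => // le_yx; rewrite below_eq0 // => v /(path_leq_ge pa).
  exact: leq_trans.
- rewrite (IH i (path_sorted pa)) //.
  case: (ltnP x y) => [_|le_yx]; first by rewrite add1n ltnS.
  by rewrite below_eq0 // => v /(path_leq_ge pa); apply: leq_trans.
Qed.

(* For [st = true] this is membership of (m, n) in the path; for [st = false] the
   coordinates are exchanged, so that L^perp and L are treated alike. *)
Definition on_path (st : bool) (w : seq bool) (m n : nat) : Prop :=
  exists2 k, k <= size w &
    (count (pred1 st) (take k w), count (pred1 (~~ st)) (take k w)) = (m, n).

Lemma on_path_nil st m n : on_path st [::] m n <-> m = 0 /\ n = 0.
Proof.
split; first by case=> k _ /= [<- <-].
by case=> -> ->; exists 0.
Qed.

Lemma on_path_cons st c w m n : on_path st (c :: w) m n <->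
  (m = 0 /\ n = 0) \/
  (if c == st then 0 < m /\ on_path st w m.-1 n
   else 0 < n /\ on_path st w m n.-1).
Proof.
split=> [[[|k] /= le_k]|].
- by case=> <- <-; left.
- by case: st c => [] [] /= [<- <-]; right; split=> //; exists k.
- case=> [[-> ->]|]; first by exists 0.
  by case: st c => [] [] /= [pos [k le_k [em en]]]; exists k.+1 => //=;
     rewrite em en add1n add0n prednK.
Qed.

Lemma on_path_fill st d w m n : on_path st (nseq d (~~ st) ++ w) m n <->
  (m = 0 /\ n < d) \/ (d <= n /\ on_path st w m (n - d)).
Proof.
elim: d n => [|d IH] n /=; first by rewrite subn0; split=> [h|[[]|[]]] //; right.
rewrite on_path_cons; have -> : (~~ st == st) = false by case: (st).
rewrite IH; case: n => [|n] /=; last by rewrite subSS; intuition lia.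
by split=> [[[->]|[]]|[[->]|[]]] // _; left.
Qed.

(** The word starts after [cur] fill steps, so [n] is measured from [cur]. At height [cur + n] the
    path occupies the interval from the number of [st] steps strictly lower to the number of those
    at most that high. *)
Lemma on_path_word st a cur tot m n :
  path leq cur a -> all (fun v => v <= tot) a -> cur <= tot ->
  on_path st (path_word st (~~ st) cur a tot) m n <->
  (n + cur <= tot) && (below a (cur + n) <= m <= below a (cur + n).+1).
Proof.
elim: a cur m n => [|x a IH] cur m n /=.
  move=> _ _ le_cur; rewrite -[nseq _ _]cats0 on_path_fill on_path_nil /below /=.
  by lia.
case/andP=> le_cx pa /andP[le_xt at_] le_ct.
rewrite on_path_fill on_path_cons eqxx IH //.
have small y : y <= x -> below a y = 0.
  by move=> le_y; apply: below_eq0 => v /(path_leq_ge pa); apply: leq_trans.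
rewrite !below_cons.
(* Below the first [st] step both counts vanish; above it the induction hypothesis applies with [x]
   as new origin. *)
case: (ltngtP n (x - cur)) => cmp.
- by rewrite (small (cur + n)) ?(small (cur + n).+1); lia.
- have -> : x + (n - (x - cur)) = cur + n by lia.
  by lia.
- have -> : cur + n = x by lia.
  by rewrite cmp subnn addn0 small //; lia.
Qed.

Lemma mem_path_points w m n : (m, n) \in path_points w <-> on_path true w m n.
Proof.
have e1 u : count id u = count (pred1 true) u by apply: eq_count => -[].
have e2 u : count negb u = count (pred1 (~~ true)) u by apply: eq_count => -[].
split.
  by case/mapP=> k; rewrite mem_iota add0n ltnS e1 e2 => le_k [-> ->]; exists k.
case=> k le_k <-; apply/mapP; exists k; first by rewrite mem_iota add0n ltnS.
by rewrite e1 e2.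
Qed.

Lemma on_path_swap st w m n : on_path (~~ st) w m n <-> on_path st w n m.
Proof. by split=> -[k le_k]; rewrite ?negbK => -[<- <-]; exists k; rewrite ?negbK. Qed.

Lemma heightsE_N w : heightsE (false :: w) = map S (heightsE w).
Proof.
rewrite /heightsE /= -(addn0 1) iotaDl filter_map -!map_comp.
by apply: eq_map => k.
Qed.

Lemma heightsE_E w : heightsE (true :: w) = 0 :: heightsE w.
Proof.
rewrite /heightsE /= -(addn0 1) iotaDl filter_map -!map_comp.
by congr cons; apply: eq_map => k.
Qed.

Lemma heightsE_nseqN d w :
  heightsE (nseq d false ++ w) = [seq d + h | h <- heightsE w].
Proof.
elim: d => [|d IH] /=; first by rewrite map_id.
by rewrite heightsE_N IH -map_comp.
Qed.

Lemma heightsE_nseqE d w : heightsE (nseq d true ++ w) = nseq d 0 ++ heightsE w.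
Proof. by elim: d => //= d IH; rewrite heightsE_E IH. Qed.

Lemma heightsE_Lperp a cur tot : path leq cur a ->
  heightsE (path_word true false cur a tot) = [seq x - cur | x <- a].
Proof.
elim: a cur => [|x a IH] cur /=.
  by rewrite -[nseq _ _]cats0 heightsE_nseqN.
case/andP=> le_cx pa; rewrite heightsE_nseqN heightsE_E /= addn0 IH //.
congr cons; rewrite -map_comp; apply/eq_in_map => v va /=.
by have := path_leq_ge pa va; lia.
Qed.

(** The E step leaving abscissa [x] comes after exactly the N steps placed at abscissa at most [x],
    whence the successor. *)
Lemma heightsE_Lb b cur tot : path leq cur b ->
  all (fun v => v <= tot) b ->
  heightsE (path_word false true cur b tot) =
  [seq below b x.+1 | x <- iota cur (tot - cur)].
Proof.
elim: b cur => [|x b IH] cur /=.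
  move=> _ _; rewrite -[nseq _ _]cats0 heightsE_nseqE cats0.
  by move: (tot - cur) => d; elim: d cur => //= d IH c; rewrite -IH.
case/andP=> le_cx pb /andP[le_xt bt].
rewrite heightsE_nseqE heightsE_N IH // -map_comp.
have -> : tot - cur = (x - cur) + (tot - x) by lia.
rewrite iotaD map_cat subnKC //; congr (_ ++ _).
  apply: (@eq_from_nth _ 0); rewrite ?size_map ?size_iota size_nseq // => i lti.
  rewrite nth_nseq lti (nth_map 0) ?size_iota // nth_iota // below_eq0 // => v.
  by rewrite inE => /orP[/eqP->|/(path_leq_ge pb)]; lia.
apply/eq_in_map => c; rewrite mem_iota below_cons => /andP[le_xc _] /=.
by rewrite ltnS le_xc.
Qed.

(** The common condition of the overview, with the sizes of the lists as p and q. It is boolean,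
    over bounded ranges, so that it can be summed as 0 or 1. *)
Definition crossing_free (s t : seq nat) : bool :=
  [forall x : 'I_(size s).+1, forall y : 'I_(size t).+1,
    [|| (x == 0 :> nat) && (y == 0 :> nat),
        (x == size s :> nat) && (y == size t :> nat),
        x < below s y | y < below t x]].

Lemma crossing_freeP s t : reflect
  (forall x y, x <= size s -> y <= size t -> below s y <= x -> below t x <= y ->
     (x = 0 /\ y = 0) \/ (x = size s /\ y = size t))
  (crossing_free s t).
Proof.
apply: (iffP forallP) => [cf x y lex ley bx ty | cf x].
  have /forallP/(_ (Ordinal (ley : y < (size t).+1)))
    := cf (Ordinal (lex : x < (size s).+1)).
  by move=> /=; lia.
apply/forallP => y; have := cf x y (ltn_ord x) (ltn_ord y).
by case: (leqP (below s y) x) => // h1; case: (leqP (below t x) y) => // h2;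
  rewrite ?orbT // => /(_ isT isT) [] [-> ->]; rewrite !eqxx ?orbT.
Qed.

(** An entry of [s] that is at least [size t] would make [(size s - 1, size t)] a forbidden
    point. *)
Lemma crossing_free_all s t : 0 < size t -> crossing_free s t ->
  all (fun v => v < size t) s.
Proof.
move=> t0 /crossing_freeP cf; rewrite -below_all eqn_leq below_size leqNgt.
apply/negP => lt_s.
have := cf (size s).-1 (size t); have := below_size t (size s).-1; lia.
Qed.

Lemma crossing_freeC s t : crossing_free s t = crossing_free t s.
Proof.
by apply/crossing_freeP/crossing_freeP => cf x y lex ley bx ty;
  have := cf y x ley lex ty bx; tauto.
Qed.

(** When L_b is weakly above L^perp, a point satisfying both inequalities is squeezed onto both
    paths. Conversely common points satisfy both inequalities, and an E step of L^perp higher than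
    that of L_b produces a forbidden point. *)
Lemma paths_crossing_free a b : 0 < size a -> 0 < size b ->
  sorted leq a -> sorted leq b ->
  all (fun v => v <= size b) a -> all (fun v => v <= size a) b ->
  let La := Lperp (size b) a in let Lbb := Lb (size a) b in
  (weakly_above (size a) Lbb La /\
   forall pt, pt \in path_points La -> pt \in path_points Lbb ->
     pt = (0, 0) \/ pt = (size a, size b)) <-> crossing_free a b.
Proof.
move=> a0 b0 sa sb alla allb La Lbb.
have path0 u : sorted leq u -> path leq 0 u by case: u.
have hLa i : i < size a -> nth 0 (heightsE La) i = nth 0 a i.
  move=> lti; rewrite heightsE_Lperp ?path0 // (nth_map 0) //; exact: subn0.
have hLb i : i < size a -> nth 0 (heightsE Lbb) i = below b i.+1.
  move=> lti; rewrite heightsE_Lb ?path0 // (nth_map 0) ?size_iota ?subn0 //.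
  by rewrite nth_iota.
have pLa x y : (x, y) \in path_points La <->
    (y <= size b) && (below a y <= x <= below a y.+1).
  by rewrite mem_path_points on_path_word ?path0 // addn0.
have pLb x y : (x, y) \in path_points Lbb <->
    (x <= size a) && (below b x <= y <= below b x.+1).
  rewrite mem_path_points -(on_path_swap true).
  by rewrite (@on_path_word false) ?path0 // addn0.
have wab : weakly_above (size a) Lbb La <->
    forall i, i < size a -> nth 0 a i <= below b i.+1.
  by split=> h i lti; have := h i lti; rewrite hLa // hLb.
split=> [[/wab above meet]|/crossing_freeP cf].
- apply/crossing_freeP => x y lex ley ax bx.
  (* Otherwise the E step of L^perp with index [below a y.+1] is higher than [y], while the one of
     L_b is at height at most [below b x <= y]. *)
  have cx : x <= below a y.+1.
    rewrite leqNgt; apply/negP => ltx.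
    have lti : below a y.+1 < size a by apply: leq_trans lex.
    have := above _ lti; have := nth_sorted_below y.+1 sa lti.
    by rewrite ltnn; have := leq_below b ltx; lia.
  have cy : y <= below b x.+1.
    rewrite leqNgt; apply/negP => lty.
    have [ltx|gex] := ltnP x (size a).
      have := above _ ltx; have := nth_sorted_below y sa ltx; lia.
    have e : below b x.+1 == size b.
      by rewrite below_all; apply: sub_all allb => v; lia.
    by rewrite (eqP e) in lty; lia.
  case: (meet (x, y)); rewrite ?pLa ?pLb; try lia.
  + by case=> -> ->; left.
  + by case=> -> ->; right.
- split=> [|[x y] /pLa h1 /pLb h2].
    (* If the E steps of index [i] violate the order, the point [(i, a_i)] is forbidden. *)
    apply/wab => i lti.
    rewrite leqNgt; apply/negP => lta.
    have ale : nth 0 a i <= size b by apply: (allP alla); apply: mem_nth.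
    have := cf i (nth 0 a i); have := nth_sorted_below (nth 0 a i) sa lti.
    by have := @leq_below b i i.+1; rewrite ltnn; lia.
  by case: (cf x y); try lia; case=> -> ->; [left|right].
Qed.

(** The vector [g - 1]. Since [0.-1 = 0], positivity of [g] is stated separately. *)
Definition pvals n (g : 'I_n -> nat) : seq nat := [seq (g i).-1 | i <- enum 'I_n].

Lemma size_pvals n (g : 'I_n -> nat) : size (pvals g) = n.
Proof. by rewrite size_map size_enum_ord. Qed.

Lemma mem_pvals n (g : 'I_n -> nat) i : (g i).-1 \in pvals g.
Proof. by apply: (map_f (fun i => (g i).-1)); rewrite mem_enum. Qed.

Lemma crossing_free_perm s s' t t' : perm_eq s s' -> perm_eq t t' ->
  crossing_free s t = crossing_free s' t'.
Proof.
move=> ps pt; have bs y : below s y = below s' y by apply/permP.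
have bt y : below t y = below t' y by apply/permP.
by apply/crossing_freeP/crossing_freeP => cf x y;
  have := cf x y; rewrite (perm_size ps) (perm_size pt) bs bt.
Qed.

(** Sorting preserves [below], and the upper bounds on the values are recovered from
    [crossing_free_all]. *)
Lemma PPF_pq_crossing_free p q (fP : 'I_p -> nat) (fQ : 'I_q -> nat) :
  0 < p -> 0 < q ->
  PPF_pq fP fQ <-> [/\ forall i, 0 < fP i, forall j, 0 < fQ j &
                      crossing_free (pvals fP) (pvals fQ)].
Proof.
move=> p0 q0.
have perm_inc n (g : 'I_n -> nat) :
    perm_eq (minus1 (inc [seq g i | i <- enum 'I_n])) (pvals g).
  rewrite /pvals (map_comp predn g) -/(minus1 _); apply: perm_map.
  by rewrite /inc perm_sort.
have sorted_inc n (g : 'I_n -> nat) :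
    sorted leq (minus1 (inc [seq g i | i <- enum 'I_n])).
  rewrite /minus1 sorted_map; apply: (@sub_sorted _ leq).
    by move=> x y /=; lia.
  exact: (sort_sorted leq_total).
have size_inc n (g : 'I_n -> nat) :
    size (minus1 (inc [seq g i | i <- enum 'I_n])) = n.
  by rewrite (perm_size (perm_inc _ _)) size_pvals.
have all_inc n (g : 'I_n -> nat) m : (forall i, 0 < g i <= m.+1) ->
    all (fun v => v <= m) (minus1 (inc [seq g i | i <- enum 'I_n])).
  move=> h; rewrite (perm_all _ (perm_inc _ _)); apply/allP => v /mapP[i _ ->].
  by have := h i; lia.
have key := @paths_crossing_free (minus1 (inc [seq fP i | i <- enum 'I_p]))
  (minus1 (inc [seq fQ i | i <- enum 'I_q])).
rewrite (crossing_free_perm (perm_inc _ _) (perm_inc _ _)) !size_inc in key.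
have {}key := key p0 q0 (sorted_inc _ _) (sorted_inc _ _).
split.
  case=> hP hQ wa meet; split=> [i|j|]; first by case/andP: (hP i).
    by case/andP: (hQ j).
  by apply: (iffLR (key _ _)); [exact: all_inc|exact: all_inc|split].
case=> hP hQ cf.
have hP' i : 0 < fP i <= q.+1.
  have := crossing_free_all _ cf; rewrite !size_pvals.
  move=> /(_ q0)/allP/(_ _ (mem_pvals fP i)).
  have := hP i; lia.
have hQ' i : 0 < fQ i <= p.+1.
  move: cf; rewrite crossing_freeC => cf.
  have := crossing_free_all _ cf; rewrite !size_pvals.
  move=> /(_ p0)/allP/(_ _ (mem_pvals fQ i)).
  have := hQ i; lia.
by have [] := iffRL (key (all_inc _ _ _ hP') (all_inc _ _ _ hQ')) cf; split.
Qed.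

Lemma below_enum (I : finType) (X : {set I}) (F : I -> nat) y :
  below [seq F i | i <- enum X] y = #|[set i in X | F i < y]|.
Proof.
rewrite /below count_map -size_filter cardE; apply: perm_size.
apply: uniq_perm; [exact/filter_uniq/enum_uniq | exact: enum_uniq | move=> i].
by rewrite mem_filter !mem_enum /= andbC [RHS]inE.
Qed.

Lemma below_pvals n (g : 'I_n -> nat) y : 
  (forall i, 0 < g i) -> below (pvals g) y = #|[set i | g i <= y]|.
Proof.
move=> g0; rewrite /pvals -(@eq_enum _ setT) ?below_enum; last by move=> i; rewrite inE.
apply: eq_card => i.
by rewrite !inE -ltnS; have := g0 i; case: (g i).
Qed.

(** * The tripartite graph *)

(** Only the first block has to be parking: for [S] in the complement, edges leaving [S] go either
    to [A], where they are absorbed by the shift [deg A], or to vertices of the second induced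
    graph. *)
Lemma decomposable_of_park (V : finType) (s : V) mult (f : V -> nat) (A : {set V}) :
  G_parking s mult f -> A != set0 -> ~: A :\ s != set0 -> s \notin A ->
  (forall v, v \notin A -> v != s -> deg mult A v < f v) ->
  park_on s mult A f -> decomposable s mult f A (~: A :\ s).
Proof.
move=> [f0 fpark] A0 B0 sA lt_deg parkA; split; [split=> // | split=> //; split].
- by apply/setP => v; rewrite !inE; case: (v \in A); rewrite ?andbF.
- apply/setP => v; rewrite !inE; case: (eqVneq v s) => [->|_]; last exact: orbN.
  by rewrite (negbTE sA).
- move=> v; rewrite !inE => /andP[vs vA]; by rewrite subn_gt0 lt_deg.
- move=> S sSB S0; have [|v vS le_f] := fpark S _ S0.
    by apply: subset_trans sSB _; apply/subsetP => v; rewrite !inE => /andP[].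
  exists v => //; rewrite leq_subLR; apply: leq_trans le_f _.
  rewrite /deg (big_setID A) /=; apply: leq_add.
    rewrite big_mkcond [leqRHS]big_mkcond; apply: leq_sum => w _ /=.
    by rewrite inE; case: (w \in A); rewrite ?andbF //; case: ifP.
  apply: eq_leq; apply: eq_bigl => w; rewrite !inE.
  have /implyP := subsetP sSB w; rewrite !inE.
  have /implyP : w == s -> w \notin A by move/eqP->.
  by case: (w \in A); case: (w \in S); case: (w == s).
Qed.

Section Tripartite.
Variables (p q : nat).
Hypotheses (p_gt0 : 0 < p) (q_gt0 : 0 < q).
Notation V := (option ('I_p + 'I_q)).
Implicit Types (A B S : {set V}).

Definition inP A : {set 'I_p} := [set i | Some (inl i) \in A].
Definition inQ A : {set 'I_q} := [set j | Some (inr j) \in A].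

Lemma deg_K A v : deg (@Kmult p q) A v =
  (if v is Some _ then None \in A : nat else 0) +
  (if v is Some (inl _) then 0 else #|inP A|) +
  (if v is Some (inr _) then 0 else #|inQ A|).
Proof.
rewrite /deg big_mkcond (bigD1 None) //= (reindex_omap Some id) //=; last by case.
under eq_bigl => w do rewrite eqxx.
rewrite big_sumType /=; rewrite -!big_mkcond /=; rewrite addnA; congr (_ + _ + _).
- by case: v => [[]|] /=; case: (None \in A).
- by case: v => [[a|a]|]; rewrite /Kmult /= ?sum1dep_card // big1.
- by case: v => [[a|a]|]; rewrite /Kmult /= ?sum1dep_card // big1.
Qed.

Lemma deg_inl A i : deg (@Kmult p q) A (Some (inl i)) = (None \in A) + #|inQ A|.
Proof. by rewrite deg_K addn0. Qed.

Lemma deg_inr A j : deg (@Kmult p q) A (Some (inr j)) = (None \in A) + #|inP A|.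
Proof. by rewrite deg_K addn0. Qed.

Variable f : 'I_p + 'I_q -> nat.
Hypothesis f_gt0 : forall v, 0 < f v.
Notation g := (liftf f).
Notation s := (pvals (fun i => f (inl i))).
Notation t := (pvals (fun j => f (inr j))).

Lemma below_s y : below s y = #|[set i | f (inl i) <= y]|.
Proof. exact: below_pvals. Qed.

Lemma below_t y : below t y = #|[set j | f (inr j) <= y]|.
Proof. exact: below_pvals. Qed.

(** In contrapositive form: off [A], [f] exceeds the degree into [A], so that the shifted function
    on the second block is positive. *)
Definition closed_block A : Prop :=
  [/\ None \notin A, forall i, f (inl i) <= #|inQ A| -> i \in inP A &
      forall j, f (inr j) <= #|inP A| -> j \in inQ A].

(** For [S] in [A], let [C] be the rest of [A] with the root. A vertex outside [C] with small value
    lies in [A] by closedness, hence in [S], and is the witness. If there is none, the sizes of [C]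
    give a point excluded by minimality. *)
Lemma park_closed_block A : closed_block A ->
  (forall x y, x <= #|inP A| -> y <= #|inQ A| -> below s y <= x -> below t x <= y ->
     (x = 0 /\ y = 0) \/ (x = #|inP A| /\ y = #|inQ A|)) ->
  (exists2 v, v \in A & g v = 1) ->
  park_on None (@Kmult p q) A g.
Proof.
move=> [nA cP cQ] minA [v1 v1A gv1]; split=> [[v _|]|S sSA S0]; first exact: f_gt0.
  by rewrite (negbTE nA).
have nS : None \notin S by apply: contra nA; apply: (subsetP sSA).
set C := (A :|: [set None]) :\: S.
have CN : None \in C by rewrite !inE nS orbT.
have CP i : (i \in inP C) = (i \in inP A) && (Some (inl i) \notin S).
  by rewrite !inE orbF andbC.
have CQ i : (i \in inQ C) = (i \in inQ A) && (Some (inr i) \notin S).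
  by rewrite !inE orbF andbC.
have sCP : inP C \subset inP A by apply/subsetP => i; rewrite CP => /andP[].
have sCQ : inQ C \subset inQ A by apply/subsetP => i; rewrite CQ => /andP[].
have leP := subset_leq_card sCP; have leQ := subset_leq_card sCQ.
have [lts|les] := ltnP #|inP C| (below s #|inQ C|).
  have /subsetPn[i] : ~~ ([set i | f (inl i) <= #|inQ C|] \subset inP C).
    by apply: contraTN lts => /subset_leq_card; rewrite below_s -leqNgt.
  rewrite inE CP => le_i; rewrite cP ?(leq_trans le_i) //= negbK => iS.
  by exists (Some (inl i)); rewrite // deg_inl CN; apply: (leq_trans le_i); lia.
have [ltt|let_] := ltnP #|inQ C| (below t #|inP C|).
  have /subsetPn[j] : ~~ ([set j | f (inr j) <= #|inP C|] \subset inQ C).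
    by apply: contraTN ltt => /subset_leq_card; rewrite below_t -leqNgt.
  rewrite inE CQ => le_j; rewrite cQ ?(leq_trans le_j) //= negbK => jS.
  by exists (Some (inr j)); rewrite // deg_inr CN; apply: (leq_trans le_j); lia.
(* Here [C] without the root is empty or all of [A]. If empty, [S] is [A] and the vertex of value 1
   uses its edge to the root; otherwise [S] is empty. *)
case: (minA _ _ leP leQ les let_) => -[eP eQ].
  exists v1; last by rewrite gv1; case: (v1) v1A => [[i|j]|];
    rewrite ?deg_inl ?deg_inr ?CN // (negbTE nA).
  apply: contraT => v1S; case: v1 v1A v1S {gv1} => [[i|j]|] vA vS;
    last by rewrite (negbTE nA) in vA.
    by have := card0_eq eP i; rewrite CP inE vA vS.
  by have := card0_eq eQ j; rewrite CQ inE vA vS.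
have [v vS] := set0Pn _ S0; have vA := subsetP sSA _ vS; exfalso.
have eqPA : inP C = inP A by apply/eqP; rewrite eqEcard sCP eP leqnn.
have eqQA : inQ C = inQ A by apply/eqP; rewrite eqEcard sCQ eQ leqnn.
case: v vS vA => [[i|j]|] vS vA; last by rewrite (negbTE nA) in vA.
  by have := CP i; rewrite eqPA inE vA vS.
by have := CQ j; rewrite eqQA inE vA vS.
Qed.

Lemma closed_block_deg A v : closed_block A -> v \notin A -> v != None ->
  deg (@Kmult p q) A v < g v.
Proof.
move=> [nA cP cQ]; case: v => [[i|j]|] // vA _ /=.
  by rewrite deg_inl (negbTE nA) ltnNge; apply: contra vA => /cP; rewrite inE.
by rewrite deg_inr (negbTE nA) ltnNge; apply: contra vA => /cQ; rewrite inE.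
Qed.

Lemma blockC_neq0 A : None \notin A -> (#|inP A| < p) || (#|inQ A| < q) ->
  ~: A :\ None != set0.
Proof.
move=> nA ltA; apply/set0Pn; case/orP: ltA => ltA.
  have /subsetPn[i _ iA] : ~~ (setT \subset inP A).
    by apply: contraTN ltA => /subset_leq_card; rewrite cardsT card_ord -leqNgt.
  by exists (Some (inl i)); move: iA; rewrite !inE.
have /subsetPn[i _ iA] : ~~ (setT \subset inQ A).
  by apply: contraTN ltA => /subset_leq_card; rewrite cardsT card_ord -leqNgt.
by exists (Some (inr i)); move: iA; rewrite !inE.
Qed.

(** A minimal nontrivial point yields the first block of a decomposition; conversely the sizes of
    any first block form a forbidden point. *)
Lemma PPF_K_crossing_free_aux : PPF_K f <-> crossing_free s t.
Proof.
have size_s : size s = p by rewrite size_pvals.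
have size_t : size t = q by rewrite size_pvals.
have fullP : inP (~: [set None]) = setT by apply/setP => i; rewrite !inE.
have fullQ : inQ (~: [set None]) = setT by apply/setP => i; rewrite !inE.
split.
- case=> fpark fprime; apply/crossing_freeP; rewrite size_s size_t => x y.
  have [n] := ubnP (x + y); elim: n x y => // n IH x y lt_n lex ley bs bt.
  case: (eqVneq (x, y) (0, 0)) => [[-> ->]|nz]; first by left.
  case: (eqVneq (x, y) (p, q)) => [[-> ->]|nf]; first by right.
  exfalso.
  have small x' y' : x' <= x -> y' <= y -> x' + y' < x + y ->
      below s y' <= x' -> below t x' <= y' -> x' = 0 /\ y' = 0.
    move=> lx' ly' lt' bs' bt'; case: (IH x' y') => //; lia.
  (* The parking condition for all non-root vertices at once: the root is the only vertex outside,
     joined by single edges. *)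
  have one1 : exists v, f v = 1.
    have [|[v|] vS] := fpark.2 (~: [set None]) (subxx _); last 1 first.
    - by rewrite !inE in vS.
    - by apply/set0Pn; exists (Some (inl (Ordinal p_gt0))); rewrite !inE.
    move=> le_v; exists v; apply/eqP; rewrite eqn_leq f_gt0 andbT.
    apply: (leq_trans le_v); rewrite deg_K.
    set C := _ :\: _.
    have -> : inP C = set0 by apply/setP => k; rewrite !inE.
    have -> : inQ C = set0 by apply/setP => k; rewrite !inE.
    by rewrite !cards0; case: (v); case: (None \in C).
  have [A [cA eP eQ v1]] : exists A, [/\ closed_block A, #|inP A| = x, #|inQ A| = y
       & exists2 v, v \in A & g v = 1].
    (* On an axis the threshold set used below would be empty. Minimality leaves only [(0, 1)] and
       [(1, 0)], and a single vertex of value 1 serves as block. *)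
    case: (posnP x) => [x0|x_gt0].
      have ey : y = 1.
        apply/eqP; rewrite eqn_leq lt0n; apply/andP; split; last first.
          by move: nz; rewrite x0 xpair_eqE eqxx.
        rewrite leqNgt; apply/negP => lty.
        have := small 0 1; have := leq_below s (ltnW lty); rewrite below0; lia.
      have [[i|j] fv] := one1.
        suff : 0 < below s 1 by move: bs; rewrite ey x0; lia.
        by rewrite below_s; apply/card_gt0P; exists i; rewrite inE fv.
      exists [set Some (inr j)].
      have eQ : inQ [set Some (inr j)] = [set j] by apply/setP => k; rewrite !inE.
      have eP : inP [set Some (inr j)] = set0 by apply/setP => k; rewrite !inE.
      rewrite /closed_block eP eQ cards1 cards0 !inE; split=> //.
      + split=> // [i fi|k]; last by rewrite leqNgt f_gt0.
        have := bs; rewrite x0 ey below_s leqn0 cards_eq0 => /eqP/setP/(_ i).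
        by rewrite !inE fi.
      + by exists (Some (inr j)); rewrite ?inE.
    case: (posnP y) => [y0|y_gt0].
      have ex : x = 1.
        apply/eqP; rewrite eqn_leq x_gt0 andbT leqNgt; apply/negP => ltx.
        have := small 1 0; have := leq_below t (ltnW ltx); rewrite below0; lia.
      have [[i|j] fv] := one1; last first.
        suff : 0 < below t 1 by move: bt; rewrite ex y0; lia.
        by rewrite below_t; apply/card_gt0P; exists j; rewrite inE fv.
      exists [set Some (inl i)].
      have eQ : inQ [set Some (inl i)] = set0 by apply/setP => k; rewrite !inE.
      have eP : inP [set Some (inl i)] = [set i] by apply/setP => k; rewrite !inE.
      rewrite /closed_block eP eQ cards1 cards0 !inE; split=> //.
      + split=> // [k|j fj]; first by rewrite leqNgt f_gt0.
        have := bt; rewrite ex y0 below_t leqn0 cards_eq0 => /eqP/setP/(_ j).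
        by rewrite !inE fj.
      + by exists (Some (inl i)); rewrite ?inE.
    pose A := [set v : V | match v with Some (inl i) => f (inl i) <= y
                           | Some (inr j) => f (inr j) <= x | None => false end].
    have eP : inP A = [set i | f (inl i) <= y] by apply/setP => k; rewrite !inE.
    have eQ : inQ A = [set j | f (inr j) <= x] by apply/setP => k; rewrite !inE.
    have cP : #|inP A| = x.
      (* A strict inequality would make [(x - 1, y)] a smaller point, nonzero because [y > 0]. *)
      rewrite eP -below_s; apply/eqP; rewrite eqn_leq bs leqNgt; apply/negP => ltx.
      have := small x.-1 y; have := @leq_below t x.-1 x; lia.
    have cQ : #|inQ A| = y.
      rewrite eQ -below_t; apply/eqP; rewrite eqn_leq bt leqNgt; apply/negP => lty.
      have := small x y.-1; have := @leq_below s y.-1 y; lia.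
    exists A; split=> //.
      by split; rewrite ?cP ?cQ ?inE // => k; rewrite !inE.
    by have [[i|j] fv] := one1; [exists (Some (inl i))|exists (Some (inr j))];
      rewrite ?inE /= ?fv.
  have nA : None \notin A by case: cA.
  apply: (fprime A (~: A :\ None)); apply: decomposable_of_park => //.
  + by have [v vA _] := v1; apply/set0Pn; exists v.
  + apply: blockC_neq0 => //; rewrite eP eQ.
    by move: nf; rewrite xpair_eqE; lia.
  + by move=> v; apply: closed_block_deg.
  + apply: park_closed_block => // x' y'; rewrite eP eQ => lx' ly' bs' bt'.
    have [lt'|] := ltnP (x' + y') (x + y); first by left; apply: small.
    by right; lia.
- move=> /crossing_freeP; rewrite size_s size_t => cf; split.
  + apply: park_closed_block; rewrite ?fullP ?fullQ ?cardsT ?card_ord //.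
      by split=> [|i|j]; rewrite ?fullP ?fullQ ?inE.
    have : 0 < below s 1.
      rewrite lt0n; apply/eqP => bs1.
      by case: (cf 0 1); rewrite ?below0 ?bs1 //; lia.
    rewrite below_s => /card_gt0P[i]; rewrite inE => fi.
    exists (Some (inl i)); first by rewrite !inE.
    by apply/eqP; rewrite eqn_leq fi f_gt0.
  + move=> A B [[A0 B0 AB0 ABT] [_ [gB _]]].
    have nA : None \notin A.
      by have /setP/(_ None) := ABT; rewrite !inE eqxx => /negbT; case/norP.
    have inAB v : v != None -> v \notin A -> v \in B.
      by move=> vN vA; have /setP/(_ v) := ABT; rewrite !inE (negbTE vA) vN.
    (* Vertices outside [A] lie in [B], where positivity of the shifted function makes [f] exceed
       the degree into [A]. *)
    have bs : below s #|inQ A| <= #|inP A|.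
      rewrite below_s; apply: subset_leq_card; apply/subsetP => i.
      rewrite !inE => le_i; apply: contraT => iA.
      have := gB _ (inAB (Some (inl i)) isT iA).
      by rewrite deg_inl (negbTE nA) /= subn_gt0 ltnNge le_i.
    have bt : below t #|inP A| <= #|inQ A|.
      rewrite below_t; apply: subset_leq_card; apply/subsetP => i.
      rewrite !inE => le_i; apply: contraT => iA.
      have := gB _ (inAB (Some (inr i)) isT iA).
      by rewrite deg_inr (negbTE nA) /= subn_gt0 ltnNge le_i.
    have leP : #|inP A| <= p by rewrite -[leqRHS]card_ord max_card.
    have leQ : #|inQ A| <= q by rewrite -[leqRHS]card_ord max_card.
    case: (cf _ _ leP leQ bs bt) => -[eP eQ].
      have [[[i|j]|] vA] := set0Pn _ A0; last by rewrite vA in nA.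
        by have := card0_eq eP i; rewrite inE vA.
      by have := card0_eq eQ j; rewrite inE vA.
    have [v vB] := set0Pn _ B0.
    have vN : v != None.
      by have /setP/(_ v) := ABT; rewrite !inE vB orbT; case: (v).
    have vA : v \notin A.
      by have /setP/(_ v) := AB0; rewrite !inE vB andbT => ->.
    have tP : inP A = setT by apply/eqP; rewrite eqEcard subsetT cardsT card_ord eP leqnn.
    have tQ : inQ A = setT by apply/eqP; rewrite eqEcard subsetT cardsT card_ord eQ leqnn.
    case: v vB vN vA => [[i|j]|] // _ _.
      by have /setP/(_ i) := tP; rewrite !inE => ->.
    by have /setP/(_ j) := tQ; rewrite !inE => ->.
Qed.
End Tripartite.

Lemma PPF_K_crossing_free p q (f : 'I_p + 'I_q -> nat) : 0 < p -> 0 < q ->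
  PPF_K f <-> [/\ forall i, 0 < f (inl i), forall j, 0 < f (inr j) &
     crossing_free (pvals (fun i => f (inl i))) (pvals (fun j => f (inr j)))].
Proof.
move=> p0 q0; split=> [ppf|[fP fQ cf]].
  have f0 v : 0 < f v.
    by have [[/(_ (Some v)) pos _] _] := ppf; apply: pos; rewrite !inE.
  by split=> // ; apply: (iffLR (PPF_K_crossing_free_aux p0 q0 f0)).
by apply/PPF_K_crossing_free_aux => // -[].
Qed.

(** * Vectors with a prescribed set of small entries *)

Definition vals n N (g : {ffun 'I_n -> 'I_N}) (X : {set 'I_n}) : seq nat :=
  [seq (g i : nat) | i <- enum X].

Lemma card_ord_geq N y : #|[pred v : 'I_N | y <= v]| = N - y.
Proof.
rewrite -sum1_card -(big_geq_mkord _ _ predT (fun=> 1)).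
by rewrite sum_nat_const_nat muln1.
Qed.

(** Restriction to [X], reindexed by [enum_val], has fibres of equal size: each entry off [X] is
    free among the [N - y] values that are at least [y]. *)
Lemma sum_restrict n N (X : {set 'I_n}) y (Psi : seq nat -> nat) :
  X != set0 -> 0 < y <= N ->
  \sum_(g : {ffun 'I_n -> 'I_N} | [forall i, (g i < y) == (i \in X)])
     Psi (vals g X) =
  (N - y) ^ (n - #|X|) * \sum_(g : {ffun 'I_#|X| -> 'I_y}) Psi (vals g setT).
Proof.
move=> /set0Pn[i0 i0X] /andP[]; case: y => // y _ le_yN.
pose r (g : {ffun 'I_n -> 'I_N}) : {ffun 'I_#|X| -> 'I_y.+1} :=
  [ffun k => inord (g (enum_val k))].
rewrite (partition_big r predT) //= big_distrr /=; apply: eq_bigr => g0 _.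
(* The fibre over [g0] is a product: one value at each point of [X], all large values elsewhere. *)
pose F (i : 'I_n) : {pred 'I_N} := if i \in X
  then pred1 (widen_ord le_yN (g0 (enum_rank_in i0X i)))
  else [pred v : 'I_N | y.+1 <= v].
have famP (g : {ffun 'I_n -> 'I_N}) :
    [forall i, (g i < y.+1) == (i \in X)] && (r g == g0) = (g \in family F).
  apply/andP/familyP => [[/forallP cg /eqP rg] i | gF].
    rewrite /F; case: ifP => iX; last first.
      by have /eqP := cg i; rewrite iX ltnNge inE /= => /negbFE.
    rewrite inE -rg ffunE enum_rankK_in //; apply/eqP/val_inj => /=.
    by rewrite inordK //; have := cg i; rewrite iX => /eqP.
  split.
    apply/forallP => i; have := gF i; rewrite /F; case: ifP => _; rewrite inE /=.
      by move/eqP->; rewrite /= ltn_ord.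
    by rewrite [g i < _]ltnNge => ->.
  apply/eqP/ffunP => k; rewrite ffunE; have := gF (enum_val k); rewrite /F enum_valP.
  rewrite inE => /eqP->; apply: val_inj; rewrite /= enum_valK_in inordK //.
transitivity (\sum_(g in family F) Psi (vals g0 setT)).
  apply: eq_big => [g|g /andP[/forallP cg /eqP rg]]; first exact: famP.
  congr Psi.
  apply: (@eq_from_nth _ 0).
    by rewrite /vals !size_map -!cardE cardsT card_ord.
  rewrite /vals size_map -cardE => k ltk.
  rewrite (nth_map i0) -?cardE // (nth_map (Ordinal ltk)) -?cardE ?cardsT ?card_ord //.
  rewrite enum_setT -enumT.
  rewrite (nth_ord_enum (Ordinal ltk) (Ordinal ltk)) -rg ffunE.
  by rewrite (enum_val_nth i0) /= inordK // (eqP (cg _)) -mem_enum mem_nth -?cardE.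
rewrite sum_nat_const; congr (_ * _).
rewrite card_family foldrE big_map big_enum /=.
rewrite (bigID (mem X)) /= big1 ?mul1n => [|i iX]; last by rewrite /F iX card1.
rewrite (eq_bigr (fun=> N - y.+1)) => [|i /negbTE iX]; last by rewrite /F iX card_ord_geq.
rewrite prod_nat_const; congr (_ ^ _).
by have := cardC X; rewrite card_ord => /(canRL (addKn _)) <-; apply: eq_card.
Qed.

Lemma below_vals n N (g : {ffun 'I_n -> 'I_N}) X y :
  below (vals g X) y = #|[set i in X | g i < y]|.
Proof. exact: below_enum. Qed.

Lemma below_valsT n N (g : {ffun 'I_n -> 'I_N}) y :
  below (vals g setT) y = #|[set i | g i < y]|.
Proof. by rewrite below_vals; apply: eq_card => i; rewrite !inE. Qed.

Lemma size_vals n N (g : {ffun 'I_n -> 'I_N}) X : size (vals g X) = #|X|.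
Proof. by rewrite size_map -cardE. Qed.

(** * Decomposition along the first block *)

Section Blocks.
Variables (p q Z W : nat) (g : {ffun 'I_p -> 'I_Z}) (h : {ffun 'I_q -> 'I_W}).

(** The block cut out by the minimal point [(#|X|, #|Y|)]: each set is determined by the size of the
    other. *)
Definition first_block (X : {set 'I_p}) (Y : {set 'I_q}) : bool :=
  [&& [forall i, (g i < #|Y|) == (i \in X)],
      [forall j, (h j < #|X|) == (j \in Y)] &
      crossing_free (vals g X) (vals h Y)].

(** Entries below a threshold at most [#|Y|] all sit on [X], and symmetrically, so the counts of the
    restrictions agree with those of the full vectors. *)
Lemma first_blockP (X : {set 'I_p}) (Y : {set 'I_q}) : reflect
  [/\ X = [set i | g i < #|Y|], Y = [set j | h j < #|X|] &
   forall x y, x <= #|X| -> y <= #|Y| ->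
     below (vals g setT) y <= x -> below (vals h setT) x <= y ->
     (x = 0 /\ y = 0) \/ (x = #|X| /\ y = #|Y|)]
  (first_block X Y).
Proof.
have bX y : X = [set i | g i < #|Y|] -> y <= #|Y| ->
    below (vals g X) y = below (vals g setT) y.
  move=> eX ley; rewrite !below_vals; apply: eq_card => i; rewrite !inE.
  by rewrite eX inE; case: (ltnP (g i) y); rewrite ?andbF // => lt_y;
     rewrite (leq_trans lt_y).
have bY x : Y = [set j | h j < #|X|] -> x <= #|X| ->
    below (vals h Y) x = below (vals h setT) x.
  move=> eY lex; rewrite !below_vals; apply: eq_card => i; rewrite !inE.
  by rewrite eY inE; case: (ltnP (h i) x); rewrite ?andbF // => lt_x;
     rewrite (leq_trans lt_x).
apply: (iffP and3P) => [[/forallP eX /forallP eY /crossing_freeP cf]|[eX eY cf]].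
  have {}eX : X = [set i | g i < #|Y|] by apply/setP => i; rewrite inE (eqP (eX i)).
  have {}eY : Y = [set i | h i < #|X|] by apply/setP => i; rewrite inE (eqP (eY i)).
  split=> // x y lex ley bs bt; have := cf x y.
  by rewrite !size_vals bX // bY //; apply.
split; [by apply/forallP => i; rewrite eX inE|by apply/forallP => i; rewrite eY inE|].
apply/crossing_freeP => x y; rewrite !size_vals => lex ley.
by rewrite bX // bY //; apply: cf.
Qed.

(** The componentwise minimum of the two size pairs again satisfies both inequalities and is
    positive, so minimality identifies it with each of them. *)
Lemma first_block_uniq X Y X' Y' : X != set0 -> Y != set0 -> X' != set0 -> Y' != set0 ->
  first_block X Y -> first_block X' Y' -> X = X' /\ Y = Y'.
Proof.
rewrite -!card_gt0 => X0 Y0 X0' Y0' /first_blockP[eX eY cf] /first_blockP[eX' eY' cf'].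
have bX : below (vals g setT) #|Y| = #|X| by rewrite below_valsT -eX.
have bY : below (vals h setT) #|X| = #|Y| by rewrite below_valsT -eY.
have bX' : below (vals g setT) #|Y'| = #|X'| by rewrite below_valsT -eX'.
have bY' : below (vals h setT) #|X'| = #|Y'| by rewrite below_valsT -eY'.
pose x := minn #|X| #|X'|; pose y := minn #|Y| #|Y'|.
have lx : x <= #|X| by apply: geq_minl.
have lx' : x <= #|X'| by apply: geq_minr.
have ly : y <= #|Y| by apply: geq_minl.
have ly' : y <= #|Y'| by apply: geq_minr.
have bs : below (vals g setT) y <= x.
  by rewrite leq_min -{1}bX -bX' !leq_below.
have bt : below (vals h setT) x <= y.
  by rewrite leq_min -{1}bY -bY' !leq_below.
have x0 : 0 < x by rewrite leq_min X0.
have [[]|[e1 e2]] := cf x y lx ly bs bt; first by lia.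
have [[]|[e1' e2']] := cf' x y lx' ly' bs bt; first by lia.
by split; [rewrite eX eX' -e2 -e2' | rewrite eY eY' -e1 -e1'].
Qed.

(** Among the points with positive coordinates, one of which is [(p, q)], take one with least
    sum. *)
Lemma first_block_exists : 0 < p -> 0 < q ->
  0 < below (vals g setT) 1 -> 0 < below (vals h setT) 1 ->
  exists X Y, [/\ X != set0, Y != set0 & first_block X Y].
Proof.
move=> p0 q0 g0 h0.
pose bad n := [exists x : 'I_p.+1, exists y : 'I_q.+1,
  [&& 0 < x, 0 < y, x + y == n, below (vals g setT) y <= x & below (vals h setT) x <= y]].
have badP n x y : x <= p -> y <= q -> 0 < x -> 0 < y -> x + y = n ->
    below (vals g setT) y <= x -> below (vals h setT) x <= y -> bad n.
  move=> lex ley x0 y0 e bs bt; apply/existsP; exists (Ordinal (lex : x < p.+1)).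
  by apply/existsP; exists (Ordinal (ley : y < q.+1)); apply/and5P; split=> //=; apply/eqP.
have exbad : exists n, bad n.
  exists (p + q); apply: (badP _ p q) => //.
    by apply: leq_trans (below_size _ _) _; rewrite size_vals cardsT card_ord.
  by apply: leq_trans (below_size _ _) _; rewrite size_vals cardsT card_ord.
case: (ex_minnP exbad) => n /existsP[[x ltx] /existsP[[y lty] /= bad_xy]] minn.
case/and5P: bad_xy => x0 y0 /eqP e bs bt.
have small x' y' : x' <= x -> y' <= y -> 
    below (vals g setT) y' <= x' -> below (vals h setT) x' <= y' ->
    (x' = 0 /\ y' = 0) \/ (x' = x /\ y' = y).
  move=> lx' ly' bs' bt'.
  (* As both vectors take the value 0, a point on an axis can only be the origin. *)
  have x0' : 0 < y' -> 0 < x' by move=> /(leq_below (vals g setT)); lia.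
  have y0' : 0 < x' -> 0 < y' by move=> /(leq_below (vals h setT)); lia.
  case: (posnP x') => [xz|xp]; first by left; lia.
  by right; have := minn (x' + y') (badP _ x' y' _ _ _ _ erefl bs' bt'); lia.
have eX : below (vals g setT) y = x.
  apply/eqP; rewrite eqn_leq bs leqNgt; apply/negP => lt.
  have := small x.-1 y; have := @leq_below (vals h setT) x.-1 x; lia.
have eY : below (vals h setT) x = y.
  apply/eqP; rewrite eqn_leq bt leqNgt; apply/negP => lt.
  have := small x y.-1; have := @leq_below (vals g setT) y.-1 y; lia.
exists [set i | g i < y], [set j | h j < x].
rewrite -!card_gt0 -!below_valsT eX eY; split=> //.
by apply/first_blockP; rewrite -!below_valsT eX eY.
Qed.

(** If one of the vectors avoids 0, then [(0, 1)] or [(1, 0)] contradicts the minimality of any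
    nonempty block. *)
Lemma sum_first_block : 0 < p -> 0 < q ->
  \sum_(X : {set 'I_p} | X != set0) \sum_(Y : {set 'I_q} | Y != set0)
     (first_block X Y : nat) =
  (0 < below (vals g setT) 1) * (0 < below (vals h setT) 1).
Proof.
move=> p0 q0; rewrite pair_big_dep /=.
case: (boolP ((0 < below (vals g setT) 1) && (0 < below (vals h setT) 1))).
  move=> /andP[g1 h1]; rewrite g1 h1.
  have [X [Y [X0 Y0 bXY]]] := first_block_exists p0 q0 g1 h1.
  rewrite (bigD1 (X, Y)) /= ?X0 ?Y0 // bXY big1 // => -[X' Y'] /= /andP[/andP[X0' Y0']].
  apply: contraNeq; rewrite eqb0 negbK => bXY'.
  by have [-> ->] := first_block_uniq X0 Y0 X0' Y0' bXY bXY'.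
move=> nz; rewrite big1 => [|[X Y] /= /andP[]].
  by move: nz; case: (0 < _); case: (0 < _).
rewrite -!card_gt0 => X0 Y0; apply/eqP; rewrite eqb0; apply: contra nz.
move=> /first_blockP[_ _ cf]; apply/andP; split; rewrite lt0n; apply/eqP => e.
  by case: (cf 0 1); rewrite ?below0 ?e //; lia.
by case: (cf 1 0); rewrite ?below0 ?e //; lia.
Qed.
End Blocks.

(** The number R(x, y) of the overview. For positive sizes the bounds on the entries lose nothing,
    by [crossing_free_all]. *)
Definition nb_crossing_free (x y : nat) : nat :=
  \sum_(g : {ffun 'I_x -> 'I_y}) \sum_(h : {ffun 'I_y -> 'I_x})
    (crossing_free (vals g setT) (vals h setT) : nat).

Lemma sum_over_card n (F : nat -> nat) :
  \sum_(X : {set 'I_n} | X != set0) F #|X| = \sum_(1 <= x < n.+1) 'C(n, x) * F x.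
Proof.
rewrite (partition_big (fun X : {set 'I_n} => inord #|X| : 'I_n.+1)
  (fun x : 'I_n.+1 => 0 < x)) /=; last first.
  move=> X; rewrite -card_gt0 inordK // ltnS.
  by rewrite -[leqRHS]card_ord max_card.
rewrite (big_geq_mkord _ _ predT); apply: eq_bigr => x x0.
transitivity (\sum_(X in [set X : {set 'I_n} | #|X| == x]) F x).
  have inE' (X : {set 'I_n}) : (inord #|X| == x) = (#|X| == x :> nat).
    by rewrite -val_eqE /= inordK // ltnS -[leqRHS]card_ord max_card.
  apply: eq_big => [X|X /andP[_]]; last by rewrite inE' => /eqP ->.
  by rewrite inE inE' -card_gt0 andbC; case: eqP => // ->.
by rewrite sum_nat_const card_draws card_ord.
Qed.

Lemma sum_has_zero n N :
  \sum_(g : {ffun 'I_n -> 'I_N}) (0 < below (vals g setT) 1 : nat) + (N - 1) ^ n = N ^ n.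
Proof.
have <- : #|[pred g : {ffun 'I_n -> 'I_N} |
               g \in ffun_on [pred v : 'I_N | 1 <= v]]| = (N - 1) ^ n.
  by rewrite card_ffun_on card_ord card_ord_geq.
have <- : #|{ffun 'I_n -> 'I_N}| = N ^ n by rewrite card_ffun !card_ord.
rewrite -sum1_card -[RHS]sum1_card big_mkcond [in X in _ + X]big_mkcond -big_split /=.
apply: eq_bigr => g _.
case: posnP => [e|]; last rewrite below_vals => /card_gt0P[i gi0].
  suff gN : g \in ffun_on [pred v : 'I_N | 1 <= v] by rewrite inE gN.
  apply/ffun_onP => i; rewrite inE /= lt0n; apply/eqP => gi.
  move/eqP: e; rewrite below_vals cards_eq0 => /eqP/setP/(_ i).
  by rewrite !inE gi.
suff /negbTE gN : g \notin ffun_on [pred v : 'I_N | 1 <= v] by rewrite inE gN.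
by apply/negP => /ffun_onP/(_ i); move: gi0; rewrite !inE /=; lia.
Qed.

(** Both sides count pairs of vectors that take the value 0, on the right sorted by first block. The
    bounds on [Z] and [W] ensure that every threshold is in range. *)
Lemma first_block_count p q Z W : 0 < p -> 0 < q -> q <= Z -> p <= W ->
  (Z ^ p - (Z - 1) ^ p) * (W ^ q - (W - 1) ^ q) =
  \sum_(1 <= x < p.+1) 'C(p, x) * \sum_(1 <= y < q.+1) 'C(q, y) *
    ((Z - y) ^ (p - x) * (W - x) ^ (q - y) * nb_crossing_free x y).
Proof.
move=> p0 q0 qZ pW.
rewrite -{1}(sum_has_zero p Z) addnK -{1}(sum_has_zero q W) addnK.
rewrite big_distrl /=.
transitivity (\sum_(g : {ffun 'I_p -> 'I_Z}) \sum_(h : {ffun 'I_q -> 'I_W})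
  \sum_(X : {set 'I_p} | X != set0) \sum_(Y : {set 'I_q} | Y != set0)
     (first_block g h X Y : nat)).
  apply: eq_bigr => g _; rewrite big_distrr /=; apply: eq_bigr => h _.
  by rewrite sum_first_block.
rewrite pair_bigA exchange_big /=.
rewrite -(sum_over_card p (fun x => \sum_(1 <= y < q.+1) 'C(q, y) *
    ((Z - y) ^ (p - x) * (W - x) ^ (q - y) * nb_crossing_free x y))).
apply: eq_bigr => X X0.
rewrite exchange_big /=.
rewrite -(sum_over_card q (fun y =>
  (Z - y) ^ (p - #|X|) * (W - #|X|) ^ (q - y) * nb_crossing_free #|X| y)).
apply: eq_bigr => Y Y0.
have leX : #|X| <= p by rewrite -[leqRHS]card_ord max_card.
have leY : #|Y| <= q by rewrite -[leqRHS]card_ord max_card.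
have X1 : 0 < #|X| by rewrite card_gt0.
have Y1 : 0 < #|Y| by rewrite card_gt0.
transitivity (\sum_(g : {ffun 'I_p -> 'I_Z} | [forall i, (g i < #|Y|) == (i \in X)])
  \sum_(h : {ffun 'I_q -> 'I_W} | [forall j, (h j < #|X|) == (j \in Y)])
     (crossing_free (vals g X) (vals h Y) : nat)).
  rewrite -(pair_bigA _ (fun g h => first_block g h X Y : nat)) /=.
  rewrite [RHS]big_mkcond; apply: eq_bigr => g _; case: ifP => cg; last first.
    by rewrite big1 // => h _; rewrite /first_block cg.
  rewrite [RHS]big_mkcond; apply: eq_bigr => h _.
  by rewrite /first_block cg; case: ifP.
under eq_bigr => g _ do rewrite (sum_restrict (fun t => crossing_free (vals g X) t)) //
  ?X1 ?(leq_trans leX) //.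
rewrite -big_distrr /= (sum_restrict (fun s => \sum_(h : {ffun 'I_#|Y| -> 'I_#|X|})
  crossing_free s (vals h setT))) ?Y1 ?(leq_trans leY) //.
by rewrite mulnA [X in X * _]mulnC.
Qed.

(** * The recurrence and the closed formula *)

Local Open Scope ring_scope.

(** For [u = 1], [v = -1] this is an n-th finite difference of a power; for [u = 'X], [v = 1 - 'X]
    it is a Bernstein-type polynomial. *)
Definition moment (R : comNzRingType) (u v : R) (n : nat) (c : R) (k : nat) : R :=
  \sum_(i < n.+1) 'C(n, i)%:R * (u ^+ i * v ^+ (n - i)) * (i%:R + c) ^+ k.

Lemma moment0 (R : comNzRingType) (u v : R) n c : moment u v n c 0 = (v + u) ^+ n.
Proof.
rewrite exprDn; apply: eq_bigr => i _.
by rewrite expr0 mulr1 mulr_natl [u ^+ _ * _]mulrC.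
Qed.

(** One factor [i + c] is split; the part with [i] is absorbed by
    [i C(n, i) = n C(n - 1, i - 1)]. *)
Lemma momentS (R : comNzRingType) (u v : R) n c k :
  moment u v n c k.+1 =
  c * moment u v n c k + n%:R * u * moment u v n.-1 (c + 1) k.
Proof.
rewrite /moment (eq_bigr (fun i : 'I_n.+1 =>
  c * ('C(n, i)%:R * (u ^+ i * v ^+ (n - i)) * (i%:R + c) ^+ k) +
  (i * 'C(n, i))%:R * (u ^+ i * v ^+ (n - i)) * (i%:R + c) ^+ k)); last first.
  by move=> i _; rewrite exprS natrM; ring.
rewrite big_split -mulr_sumr /=; congr (_ + _).
case: n => [|n]; first by rewrite big_ord1 mul0n !mul0r.
rewrite big_ord_recl mul0n !mul0r add0r mulr_sumr; apply: eq_bigr => i _.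
rewrite lift0 -mul_bin_diag /= subSS natrM exprS.
have -> : i.+1%:R + c = i%:R + (c + 1) :> R by rewrite -natr1; ring.
ring.
Qed.

Lemma moment_diff (n : nat) (c : int) (k : nat) :
  (k < n)%N -> moment 1 (-1) n c k = 0.
Proof.
elim: k n c => [|k IH] n c ltk.
  by rewrite moment0 addNr expr0n; case: n ltk.
by rewrite momentS !IH ?mulr0 ?addr0 //; lia.
Qed.

(** Since [u + v = 1], the base sum is 1, and each use of [momentS] adds at most one factor ['X]. *)
Lemma size_moment_bernstein n (c : int) k :
  (size (moment ('X : {poly int}) (1 - 'X) n c%:P k) <= k.+1)%N.
Proof.
elim: k n c => [|k IH] n c.
  by rewrite moment0 subrK expr1n size_poly1.
rewrite momentS; apply: leq_trans (size_polyD _ _) _; rewrite geq_max.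
rewrite mul_polyC -polyC_natr -mulrA mul_polyC -polyC1 -polyCD.
apply/andP; split; apply: leq_trans (size_scale_leq _ _) _.
  exact: leq_trans (IH _ _) _.
by apply: leq_trans (size_polyMleq _ _) _; rewrite size_polyX; exact: IH.
Qed.

Lemma horner_moment (u v : {poly int}) n c k z :
  (moment u v n c k).[z] = moment u.[z] v.[z] n c.[z] k.
Proof.
rewrite /moment horner_sum; apply: eq_bigr => i _.
by rewrite -!polyC_natr !hornerE.
Qed.

Lemma moment_diff_poly n (Q : {poly int}) : (size Q <= n)%N ->
  \sum_(i < n.+1) 'C(n, i)%:R * (1 ^+ i * (-1) ^+ (n - i)) * Q.[i%:R] = 0.
Proof.
move=> leQ; under eq_bigr => i _ do rewrite horner_coef mulr_sumr.
rewrite exchange_big /= big1 // => j _.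
transitivity (Q`_j * moment 1 (-1) n 0 j).
  by rewrite mulr_sumr; apply: eq_bigr => i _; rewrite addr0; ring.
by rewrite moment_diff ?mulr0 // (leq_trans (ltn_ord j)).
Qed.

Lemma poly_vanish_nat (Q : {poly int}) N :
  (forall n, (N <= n)%N -> Q.[n%:R] = 0) -> Q = 0.
Proof.
move=> Q0; apply/eqP; apply: contraT => nz.
pose rs := [seq (n%:R : int) | n <- iota N (size Q)].
suff : (size rs < size Q)%N by rewrite size_map size_iota ltnn.
apply: max_poly_roots => //.
  by apply/allP => z /mapP[n]; rewrite mem_iota => /andP[leN _] ->; apply/rootP/Q0.
by rewrite map_inj_uniq ?iota_uniq // => m n /eqP; rewrite eqr_nat => /eqP.
Qed.

(** Integer valued, so that [x - 1] and [y - 1] are not truncated; predecessors occur only in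
    exponents. *)
Definition prime_formula (x y : nat) : int :=
  x%:R ^+ y * (y%:R - 1) ^+ x.-1 + y%:R ^+ x * (x%:R - 1) ^+ y.-1
  - (x%:R + y%:R - 1) * (x%:R - 1) ^+ y.-1 * (y%:R - 1) ^+ x.-1.

Lemma sum_diff2 (p q a b : nat) : (a < p)%N || (b < q)%N ->
  \sum_(x < p.+1) \sum_(y < q.+1) 'C(p, x)%:R * 'C(q, y)%:R *
    ((-1) ^+ (p - x) * (-1) ^+ (q - y) * (x%:R - 1) ^+ a * (y%:R - 1) ^+ b) = 0 :> int.
Proof.
move=> lt_ab; transitivity (moment 1 (-1) p (-1) a * moment 1 (-1) q (-1) b : int).
  rewrite /moment mulr_suml; apply: eq_bigr => x _; rewrite mulr_sumr.
  by apply: eq_bigr => y _; rewrite !expr1n; ring.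
by case/orP: lt_ab => lt; [rewrite (@moment_diff p) // mul0r | rewrite (@moment_diff q) // mulr0].
Qed.

(** For fixed [x] the inner sum is a Bernstein moment evaluated at [x], a polynomial of degree less
    than [p], which the p-th difference in [x] kills. *)
Lemma sum_bernstein (p q : nat) : (0 < p)%N ->
  \sum_(x < p.+1) \sum_(y < q.+1) 'C(p, x)%:R * 'C(q, y)%:R *
    ((-1) ^+ (p - x) * (y%:R - 1) ^+ p.-1 * x%:R ^+ y * (1 - x%:R) ^+ (q - y)) = 0 :> int.
Proof.
move=> p0; rewrite -[RHS](@moment_diff_poly p (moment 'X (1 - 'X) q (-1)%:P p.-1)); last first.
  by rewrite -{2}(prednK p0) size_moment_bernstein.
apply: eq_bigr => x _; rewrite horner_moment !hornerE mulr_sumr.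
by apply: eq_bigr => y _; rewrite !expr1n /=; ring.
Qed.

(** [sum_bernstein] kills the first two terms of the formula and [sum_diff2] the third. Those sums
    start at 0, and the boundary accounts for the 1. *)
Lemma prime_formula_rec p q : (0 < p)%N -> (0 < q)%N ->
  \sum_(1 <= x < p.+1) \sum_(1 <= y < q.+1) 'C(p, x)%:R * 'C(q, y)%:R *
    ((1 - y%:R) ^+ (p - x) * (1 - x%:R) ^+ (q - y) * prime_formula x y) = 1.
Proof.
case: p => // p _; case: q => // q _.
(* Merging [(1 - y)^(p - x)] with [(y - 1)^(x - 1)], and likewise for the other variable, removes
   the exponents [x - 1] and [y - 1], so the summand makes sense on the axes. *)
pose t1 (p q x y : nat) : int :=
  (-1) ^+ (p - x) * (y%:R - 1) ^+ p.-1 * x%:R ^+ y * (1 - x%:R) ^+ (q - y).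
pose t3 (x y : nat) : int := (-1) ^+ (p.+1 - x) * (-1) ^+ (q.+1 - y) *
  ((x%:R + y%:R - 1) * (x%:R - 1) ^+ q * (y%:R - 1) ^+ p).
pose T x y : int := 'C(p.+1, x)%:R * 'C(q.+1, y)%:R *
  (t1 p.+1 q.+1 x y + t1 q.+1 p.+1 y x - t3 x y).
have T0 : \sum_(x < p.+2) \sum_(y < q.+2) T x y = 0.
  pose c x y : int := 'C(p.+1, x)%:R * 'C(q.+1, y)%:R.
  pose D a b := \sum_(x < p.+2) \sum_(y < q.+2) c x y *
    ((-1) ^+ (p.+1 - x) * (-1) ^+ (q.+1 - y) * (x%:R - 1) ^+ a * (y%:R - 1) ^+ b).
  have D0 a b : (a < p.+1)%N || (b < q.+1)%N -> D a b = 0 by apply: sum_diff2.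
  have S1 : \sum_(x < p.+2) \sum_(y < q.+2) c x y * t1 p.+1 q.+1 x y = 0.
    exact: sum_bernstein.
  have S2 : \sum_(x < p.+2) \sum_(y < q.+2) c x y * t1 q.+1 p.+1 y x = 0.
    rewrite -[RHS](@sum_bernstein q.+1 p.+1) // exchange_big.
    by apply: eq_bigr => y _; apply: eq_bigr => x _; rewrite /c [_ * 'C(q.+1, y)%:R]mulrC.
  (* Writing [x + y - 1] as [(x - 1) + (y - 1) + 1] splits [t3] into three double differences, each
     with an exponent below its order whether or not [p <= q]. *)
  transitivity (\sum_(x < p.+2) \sum_(y < q.+2) c x y * t1 p.+1 q.+1 x y +
    \sum_(x < p.+2) \sum_(y < q.+2) c x y * t1 q.+1 p.+1 y x -
    (D q.+1 p + D q p.+1 + D q p)); last by rewrite S1 S2 !D0 //; lia.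
  rewrite /D -!big_split -sumrB; apply: eq_bigr => x _.
  rewrite -!big_split -sumrB; apply: eq_bigr => y _.
  by rewrite /T /t3 /c !exprS /=; ring.
(* T extends the summand to x = 0 and y = 0, where only T 0 0 = -1 survives. *)
have row0 y : (0 < y <= q.+1)%N -> T 0%N y = 0.
  move=> /andP[y0 ley]; rewrite /T /t1 /t3 /= !subn0 mulr0n sub0r add0r expr0n (gtn_eqF y0).
  rewrite [(1 - y%:R) ^+ _](_ : _ = (-1) ^+ p.+1 * (y%:R - 1) ^+ p.+1); last first.
    by rewrite -exprMn; congr (_ ^+ _); ring.
  by rewrite !exprS /=; ring.
have col0 x : (0 < x <= p.+1)%N -> T x 0%N = 0.
  move=> /andP[x0 lex]; rewrite /T /t1 /t3 /= !subn0 mulr0n sub0r addr0 expr0n (gtn_eqF x0).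
  rewrite [(1 - x%:R) ^+ _](_ : _ = (-1) ^+ q.+1 * (x%:R - 1) ^+ q.+1); last first.
    by rewrite -exprMn; congr (_ ^+ _); ring.
  by rewrite !exprS /=; ring.
have T00 : T 0%N 0%N = -1.
  rewrite /T /t1 /t3 /= !subn0 !bin0 mulr0n !expr0 addr0 !sub0r ?subr0 ?oppr0 ?addr0 !expr1n.
  rewrite !exprS.
  have sq n : (-1) ^+ n * (-1) ^+ n = 1 :> int.
    by rewrite -exprD addnn -mul2n exprM sqrrN !expr1n.
  transitivity (- ((-1) ^+ p * (-1) ^+ p) - ((-1) ^+ q * (-1) ^+ q)
     + ((-1) ^+ p * (-1) ^+ p) * ((-1) ^+ q * (-1) ^+ q) : int); first by ring.
  by rewrite !sq.
have TE x y : (0 < x <= p.+1)%N -> (0 < y <= q.+1)%N ->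
    T x y = 'C(p.+1, x)%:R * 'C(q.+1, y)%:R *
    ((1 - y%:R) ^+ (p.+1 - x) * (1 - x%:R) ^+ (q.+1 - y) * prime_formula x y).
  move=> /andP[x0 lex] /andP[y0 ley]; rewrite /T /t1 /t3 /prime_formula; congr (_ * _).
  have eN (z : nat) n : (1 - z%:R) ^+ n = (-1) ^+ n * (z%:R - 1) ^+ n :> int.
    by rewrite -exprMn; congr (_ ^+ _); ring.
  have -> : ((y%:R - 1) ^+ p.+1.-1 : int) = (y%:R - 1) ^+ (p.+1 - x) * (y%:R - 1) ^+ x.-1.
    by rewrite -exprD; congr (_ ^+ _); lia.
  have -> : ((x%:R - 1) ^+ q.+1.-1 : int) = (x%:R - 1) ^+ (q.+1 - y) * (x%:R - 1) ^+ y.-1.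
    by rewrite -exprD; congr (_ ^+ _); lia.
  rewrite !eN; ring.
rewrite big_nat (eq_bigr (fun x => \sum_(1 <= y < q.+2) T x y)); last first.
  move=> x hx; rewrite !big_nat; apply: eq_bigr => y hy; rewrite TE //; lia.
rewrite -big_nat.
move: T0; rewrite big_ord_recl [X in X + _]big_ord_recl T00 big1 ?addr0; last first.
  by move=> i _; rewrite row0 // lift0 /=.
move/eqP; rewrite addr_eq0 eqr_opp => /eqP sum1; rewrite [RHS]sum1.
rewrite big_add1 big_mkord; apply: eq_bigr => x _; rewrite big_ord_recl col0 ?lift0 //= add0r.
by rewrite big_add1 big_mkord; apply: eq_bigr => y _.
Qed.

(** * Extrapolation of the counting identity *)

Lemma eq_poly_fun_nat (K : int) (n m k N : nat) (a : nat -> nat -> int)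
    (c e : nat -> nat -> nat) (z : int) :
  (forall l, (N <= l)%N -> (l%:R ^+ n - (l%:R - 1) ^+ n) * K =
     \sum_(1 <= x < m) \sum_(1 <= y < k) a x y * (l%:R - (c x y)%:R) ^+ e x y) ->
  (z ^+ n - (z - 1) ^+ n) * K =
    \sum_(1 <= x < m) \sum_(1 <= y < k) a x y * (z - (c x y)%:R) ^+ e x y.
Proof.
move=> eq_nat; pose Q : {poly int} := ('X ^+ n - ('X - 1) ^+ n) * K%:P -
  \sum_(1 <= x < m) \sum_(1 <= y < k) (a x y)%:P * ('X - (c x y)%:R%:P) ^+ e x y.
have QE t : Q.[t] = (t ^+ n - (t - 1) ^+ n) * K -
    \sum_(1 <= x < m) \sum_(1 <= y < k) a x y * (t - (c x y)%:R) ^+ e x y.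
  rewrite /Q hornerD hornerN !hornerE horner_sum; congr (_ - _).
  apply: eq_bigr => x _; rewrite horner_sum; apply: eq_bigr => y _.
  by rewrite !hornerE.
have Q0 : Q = 0.
  by apply: (@poly_vanish_nat _ N) => l leN; rewrite QE eq_nat // subrr.
by apply/eqP; rewrite -subr_eq0 -QE Q0 horner0.
Qed.

(** The identity is extended and evaluated at 1 first in Z, with W frozen in the coefficients, then
    in W; the left side becomes [1^p - 0^p = 1], and likewise for [q]. *)
Lemma nb_crossing_free_rec p q : (0 < p)%N -> (0 < q)%N ->
  \sum_(1 <= x < p.+1) \sum_(1 <= y < q.+1) 'C(p, x)%:R * 'C(q, y)%:R *
    ((1 - y%:R) ^+ (p - x) * (1 - x%:R) ^+ (q - y) * (nb_crossing_free x y)%:R) = 1 :> int.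
Proof.
move=> p0 q0.
pose b x y : int := 'C(p, x)%:R * 'C(q, y)%:R * (nb_crossing_free x y)%:R.
have castB n l : (0 < l)%N ->
    ((l ^ n - (l - 1) ^ n)%N)%:R = l%:R ^+ n - (l%:R - 1) ^+ n :> int.
  move=> l0; rewrite natrB ?natrX ?natrB //.
  by case: n => // n; rewrite leq_exp2r // leq_subr.
have base z w : (q <= z)%N -> (p <= w)%N ->
    (z%:R ^+ p - (z%:R - 1) ^+ p) * (w%:R ^+ q - (w%:R - 1) ^+ q) =
    \sum_(1 <= x < p.+1) \sum_(1 <= y < q.+1)
      b x y * (w%:R - x%:R) ^+ (q - y) * (z%:R - y%:R) ^+ (p - x) :> int.
  move=> qz pw; rewrite -!castB; try lia.
  rewrite -natrM first_block_count // natr_sum.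
  rewrite big_nat [RHS]big_nat; apply: eq_bigr => x hx.
  rewrite natrM natr_sum mulr_sumr big_nat [RHS]big_nat; apply: eq_bigr => y hy.
  by rewrite !natrM !natrX !natrB /b; lia.
have step1 w : (p <= w)%N ->
    (w%:R ^+ q - (w%:R - 1) ^+ q) * 1 =
    \sum_(1 <= x < p.+1) \sum_(1 <= y < q.+1)
      b x y * (1 - y%:R) ^+ (p - x) * (w%:R - x%:R) ^+ (q - y) :> int.
  move=> pw; have := @eq_poly_fun_nat (w%:R ^+ q - (w%:R - 1) ^+ q) p p.+1 q.+1 q
    (fun x y => b x y * (w%:R - x%:R) ^+ (q - y)) (fun x y => y) (fun x y => (p - x)%N) 1.
  move=> /(_ (fun z qz => base z w qz pw)).
  rewrite subrr expr0n (gtn_eqF p0) expr1n subr0 mul1r mulr1 => ->.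
  by apply: eq_bigr => x _; apply: eq_bigr => y _; rewrite mulrAC.
have := @eq_poly_fun_nat 1 q p.+1 q.+1 p
    (fun x y => b x y * (1 - y%:R) ^+ (p - x)) (fun x y => x) (fun x y => (q - y)%N) 1 step1.
rewrite subrr expr0n (gtn_eqF q0) expr1n subr0 mul1r => sum1; rewrite [RHS]sum1.
by apply: eq_bigr => x _; apply: eq_bigr => y _; rewrite /b; ring.
Qed.

(** In the common recurrence the term at [(p, q)] has coefficient 1, with [0^0 = 1], and all others
    have a smaller sum of indices. *)
Lemma nb_crossing_freeE p q : (0 < p)%N -> (0 < q)%N ->
  (nb_crossing_free p q)%:R = prime_formula p q.
Proof.
have [n] := ubnP (p + q); elim: n p q => // n IH p q lt_n p0 q0.
have := etrans (nb_crossing_free_rec p0 q0) (esym (prime_formula_rec p0 q0)).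
rewrite !(big_nat_recr _ _ _ p0) /= !(big_nat_recr _ _ _ q0) /=.
rewrite !binn !subnn !expr0 !mul1r.
rewrite [X in X + _ = _](_ : _ = \sum_(1 <= x < p) \sum_(1 <= y < q.+1)
  'C(p, x)%:R * 'C(q, y)%:R *
    ((1 - y%:R) ^+ (p - x) * (1 - x%:R) ^+ (q - y) * prime_formula x y)); last first.
  rewrite big_nat [RHS]big_nat; apply: eq_bigr => x hx.
  rewrite big_nat [RHS]big_nat; apply: eq_bigr => y hy.
  by rewrite IH //; lia.
move/addrI.
rewrite [X in X + _ = _](_ : _ = \sum_(1 <= y < q) 1 * 'C(q, y)%:R *
    ((1 - y%:R) ^+ 0 * (1 - p%:R) ^+ (q - y) * prime_formula p y)); last first.
  rewrite big_nat [RHS]big_nat; apply: eq_bigr => y hy.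
  by rewrite IH //; lia.
by move/addrI.
Qed.

(** * Enumeration of the prime parking functions *)

Lemma pvals_succ n N (g : {ffun 'I_n -> 'I_N}) (k : 'I_n -> nat) :
  (forall i, k i = (g i).+1) -> pvals k = vals g setT.
Proof.
move=> kE; rewrite /pvals /vals enum_setT -enumT.
by apply: eq_map => i; rewrite kE.
Qed.

Local Close Scope ring_scope.

Theorem theorem3p11 (p q : nat) (hp : 1 <= p) (hq : 1 <= q) :
  (forall f : {ffun 'I_p + 'I_q -> nat},
     PPF_pq (fun i => f (inl i)) (fun j => f (inr j)) <-> PPF_K f) /\
  (exists s : seq {ffun 'I_p + 'I_q -> nat},
     [/\ uniq s, (forall f, f \in s <-> PPF_K f) &
     ((size s)%:Z =
        (p ^ q * (q - 1) ^ (p - 1))%:Z + (q ^ p * (p - 1) ^ (q - 1))%:Z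
        - ((p + q - 1) * (p - 1) ^ (q - 1) * (q - 1) ^ (p - 1))%:Z)%R]).
Proof.
split=> [f|].
  by rewrite PPF_pq_crossing_free // PPF_K_crossing_free.
pose mk (gh : {ffun 'I_p -> 'I_q} * {ffun 'I_q -> 'I_p}) : {ffun 'I_p + 'I_q -> nat} :=
  [ffun v => match v with inl i => (gh.1 i).+1 | inr j => (gh.2 j).+1 end].
have mk_inj : injective mk.
  move=> [g h] [g' h'] /ffunP eq_mk; congr (_, _); apply/ffunP => i; apply: val_inj.
    by have := eq_mk (inl i); rewrite !ffunE => -[].
  by have := eq_mk (inr i); rewrite !ffunE => -[].
pose S := [pred gh : {ffun 'I_p -> 'I_q} * {ffun 'I_q -> 'I_p} |
  crossing_free (vals gh.1 setT) (vals gh.2 setT)].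
have mkP gh : PPF_K (mk gh) <-> gh \in S.
  rewrite PPF_K_crossing_free // inE -(pvals_succ (k := fun i => mk gh (inl i))); last first.
    by move=> i; rewrite ffunE.
  rewrite -(pvals_succ (k := fun i => mk gh (inr i))); last by move=> i; rewrite ffunE.
  by split=> [[]|cf] //; split=> // i; rewrite ffunE.
exists [seq mk gh | gh in S]; split.
- by rewrite map_inj_uniq ?enum_uniq.
- move=> f; split=> [/mapP[gh]|ppf]; first by rewrite mem_enum => ghS ->; apply/mkP.
  have [fP fQ cf] := iffLR (PPF_K_crossing_free f hp hq) ppf.
  (* Every prime parking function is in the image of [mk], its shifted values being bounded by
     [crossing_free_all]. *)
  have ltP i : (f (inl i)).-1 < q.
    have := crossing_free_all _ cf; rewrite !size_pvals => /(_ hq)/allP.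
    by apply; apply: (mem_pvals (fun i => f (inl i))).
  have ltQ j : (f (inr j)).-1 < p.
    move: cf; rewrite crossing_freeC => cf.
    have := crossing_free_all _ cf; rewrite !size_pvals => /(_ hp)/allP.
    by apply; apply: (mem_pvals (fun i => f (inr i))).
  pose gh := ([ffun i => Ordinal (ltP i)], [ffun j => Ordinal (ltQ j)]).
  have ef : f = mk gh.
    by apply/ffunP => -[i|j]; rewrite !ffunE /= prednK.
  by rewrite ef map_f // mem_enum; apply/mkP; rewrite -ef.
- rewrite size_map -cardE -natz.
  have -> : #|S| = nb_crossing_free p q.
    by rewrite /nb_crossing_free pair_bigA /= -sum1_card big_mkcond; apply: eq_bigr.
  (* The natural subtractions are exact because [p] and [q] are positive. *)
  rewrite nb_crossing_freeE // /prime_formula -!natz !natrM !natrX !natrB ?natrD; try lia.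
  by rewrite !subn1.
Qed.
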